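(* Let $\mathcal{A}=\mathbb{C}\langle a,a^*\mid aa^*-a^*a=1\rangle$ be the Weyl algebra, $N=a^*a$, $\mathcal{B}=\mathbb{C}[N]\subseteq\mathcal{A}$, let $p:\mathcal{A}\to\mathcal{B}$ be the canonical projection given by the $\mathbb{Z}$-grading of $\mathcal{A}$, and let $\mathcal{A}_+$ be the set of hermitian elements of $\mathcal{A}$ which are positive semi-definite in the Fock-Bargmann representation. Let $\operatorname{Pos}(\mathbb{N}_0)=\{f\in\mathbb{C}[N]\mid f(k)\ge 0 \text{ for all } k\in\mathbb{N}_0\}$. Then $$\mathcal{A}_+=\operatorname{Ind}\operatorname{Pos}(\mathbb{N}_0).$$
   Context: $\mathcal{A}$ is the unital complex $*$-algebra generated by $a,a^*$ with the relation $aa^*-a^*a=1$; the involution is conjugate-linear and exchanges $a$ and $a^*$. $\mathcal{A}_h=\{x\in\mathcal{A}\mid x^*=x\}$, $\mathbb{N}_0=\{0,1,2,\dots\}$. Grading: put $e_k=a^k$ for $k\ge 0$ and $e_k=(a^* )^{-k}$ for $k<0$. Then $\mathcal{A}=\bigoplus_{k\in\mathbb{Z}}e_k\mathcal{B}$ is a $\mathbb{Z}$-graded $*$-algebra, and $p:\mathcal{A}\to\mathcal{B}$ is the projection onto the degree-$0$ component: $p(\sum_k x_k)=x_0$ for $x_k\in e_k\mathcal{B}$. Induction: for a subset $\mathcal{N}\subseteq\mathcal{B}_h$, $\operatorname{Ind}\mathcal{N}:=\{x\in\mathcal{A}_h\mid p(y^*xy)\in\mathcal{N}\text{ for all }y\in\mathcal{A}\}$.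 Fock-Bargmann representation $\pi_F$: its domain $\mathcal{D}(\pi_F)$ is the space of all sequences $\varphi=(\varphi_n)_{n\in\mathbb{N}_0}\in\ell^2(\mathbb{N}_0)$ with $\sum_k k^M|\varphi_k|^2<\infty$ for all $M\in\mathbb{N}_0$, and on the standard orthonormal basis $(e_k)_{k\in\mathbb{N}_0}$ of $\ell^2(\mathbb{N}_0)$ it acts by $\pi_F(a)e_k=\sqrt{k}\,e_{k-1}$, $\pi_F(a^* )e_k=\sqrt{k+1}\,e_{k+1}$ (with $e_{-1}=0$). $\mathcal{A}_+:=\{x\in\mathcal{A}_h\mid\langle\pi_F(x)\varphi,\varphi\rangle\ge0\text{ for all }\varphi\in\mathcal{D}(\pi_F)\}$. *)

(* Defs.v *)
From HB Require Import structures.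
From mathcomp Require Import all_boot all_order all_algebra.
From mathcomp Require Import ring_quotient generic_quotient.
From mathcomp Require Import complex.
From mathcomp Require Import finmap monalg.
From mathcomp Require Import all_classical all_reals all_analysis.
Set Implicit Arguments. Unset Strict Implicit. Unset Printing Implicit Defensive.
Import Order.TTheory GRing.Theory Num.Theory.
Import numFieldNormedType.Exports.
Local Open Scope classical_set_scope.
Local Open Scope complex_scope.
Local Open Scope ring_scope.

(* The two-sided ideal generated by one element of a ring. *)
Section TwoSidedIdeal.
Variables (A : nzRingType) (r : A).

Definition ideal2 : {pred A} :=
  [pred x | `[< exists s : seq (A * A), x = \sum_(uv <- s) uv.1 * r * uv.2 >]].

Lemma ideal2P x :
  reflect (exists s : seq (A * A), x = \sum_(uv <- s) uv.1 * r * uv.2)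
          (x \in ideal2).
Proof. exact: asboolP. Qed.

Lemma ideal2_zmod_closed : zmod_closed ideal2.
Proof.
split; first by apply/ideal2P; exists [::]; rewrite big_nil.
move=> x y /ideal2P[s ->] /ideal2P[t ->]; apply/ideal2P.
exists (s ++ [seq (- uv.1, uv.2) | uv <- t]); rewrite big_cat big_map /=.
by congr (_ + _); rewrite -sumrN; apply: eq_bigr => uv _; rewrite !mulNr.
Qed.
HB.instance Definition _ := GRing.isZmodClosed.Build A ideal2 ideal2_zmod_closed.

Lemma ideal2Ml x y : y \in ideal2 -> x * y \in ideal2.
Proof.
move=> /ideal2P[s ->]; apply/ideal2P.
exists [seq (x * uv.1, uv.2) | uv <- s]; rewrite big_map mulr_sumr.
by apply: eq_bigr => uv _; rewrite !mulrA.
Qed.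

Lemma ideal2Mr x y : x \in ideal2 -> x * y \in ideal2.
Proof.
move=> /ideal2P[s ->]; apply/ideal2P.
exists [seq (uv.1, uv.2 * y) | uv <- s]; rewrite big_map mulr_suml.
by apply: eq_bigr => uv _; rewrite !mulrA.
Qed.

Lemma ideal2_gen : r \in ideal2.
Proof. by apply/ideal2P; exists [:: (1, 1)]; rewrite big_seq1 mul1r mulr1. Qed.

End TwoSidedIdeal.

Section WeylAlgebra.
Variable R : realType.
Local Notation C := (R[i]).

(* The free algebra on two letters; the letter [true] stands for [a] and the
   letter [false] for [a^*]. *)
Local Notation F := {malg C[{fmonom bool}]}.

Definition free_gen (b : bool) : F := << fmu b >>.

Definition weyl_rel : F :=
  free_gen true * free_gen false - free_gen false * free_gen true - 1.

Local Notation weyl_ideal := (ideal2 weyl_rel).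

(* The letters act on all sequences, with
     (a phi)_n = sqrt (n + 1) phi_{n+1},  (a^* phi)_n = sqrt n phi_{n-1};
   at n = 0 the second formula gives 0. *)
Definition fock_gen (b : bool) (phi : nat -> C) : nat -> C :=
  if b then fun n => (Num.sqrt (n.+1%:R : R))%:C * phi n.+1
  else fun n => (Num.sqrt (n%:R : R))%:C * phi n.-1.

Definition fock_word (w : seq bool) (phi : nat -> C) : nat -> C :=
  foldr fock_gen phi w.

Definition fock_free (x : F) (phi : nat -> C) : nat -> C :=
  fun n => \sum_(w <- msupp x) x@_w * fock_word w phi n.

Lemma fock_genE b (c : C) phi psi :
  fock_gen b (fun n => c * phi n + psi n) =
  (fun n => c * fock_gen b phi n + fock_gen b psi n).
Proof. by apply/funext => n; case: b; rewrite /= mulrDr mulrCA. Qed.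

Lemma fock_wordE w (c : C) phi psi :
  fock_word w (fun n => c * phi n + psi n) =
  (fun n => c * fock_word w phi n + fock_word w psi n).
Proof. by elim: w => //= b w ->; rewrite fock_genE. Qed.

Lemma fock_word0 w : fock_word w (fun=> 0) = (fun=> 0).
Proof.
elim: w => //= b w ->; apply/funext => n.
by case: b; rewrite /= mulr0.
Qed.

Lemma fock_word_sum w (I : Type) (r : seq I) (c : I -> C) phi :
  fock_word w (fun n => \sum_(i <- r) c i * phi i n) =
  (fun n => \sum_(i <- r) c i * fock_word w (phi i) n).
Proof.
elim: r => [|i r IHr].
  rewrite -[RHS](_ : (fun=> 0) = _); last by apply/funext => n; rewrite big_nil.
  rewrite -[RHS](fock_word0 w); congr fock_word.
  by apply/funext => n; rewrite big_nil.
rewrite -[LHS](_ : fock_word w (fun n => c i * phi i n +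
    \sum_(j <- r) c j * phi j n) = _); last first.
  by congr fock_word; apply/funext => n; rewrite big_cons.
by rewrite fock_wordE IHr; apply/funext => n; rewrite big_cons.
Qed.

Lemma fock_freeB x y phi n :
  fock_free (x - y) phi n = fock_free x phi n - fock_free y phi n.
Proof.
exact: (raddfB (mmap idfun (fun w : {fmonom bool} => fock_word w phi n))).
Qed.

Lemma fock_free_sum (I : Type) (r : seq I) (f : I -> F) phi n :
  fock_free (\sum_(i <- r) f i) phi n = \sum_(i <- r) fock_free (f i) phi n.
Proof.
exact: (raddf_sum (mmap idfun (fun w : {fmonom bool} => fock_word w phi n))).
Qed.

Lemma fock_freeU c w phi : fock_free << c *g w >> phi =
  (fun n => c * fock_word w phi n).
Proof.
by apply/funext => n; exact: (mmapU (f := idfun)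
  (h := fun w : {fmonom bool} => fock_word w phi n)).
Qed.

Lemma fock_freeZ c x phi n : fock_free (c *: x) phi n = c * fock_free x phi n.
Proof.
rewrite malgZ_def /fgscale fock_free_sum mulr_sumr; apply: eq_bigr => w _.
by rewrite fock_freeU mulrA.
Qed.

Lemma fock_freeM x y phi :
  fock_free (x * y) phi = fock_free x (fock_free y phi).
Proof.
apply/funext => n; rewrite malgME fock_free_sum.
rewrite [RHS]/fock_free; apply: eq_bigr => v _; rewrite fock_free_sum.
rewrite /(fock_free y) (fock_word_sum v _ (fun w : {fmonom bool} => y@_w)
  (fun w : {fmonom bool} => fock_word w phi)) mulr_sumr.
apply: eq_bigr => w _; rewrite fock_freeU mulrA; congr (_ * _).
by rewrite fmM /fock_word foldr_cat.
Qed.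

Lemma fock_free1 phi : fock_free 1 phi = phi.
Proof. by rewrite fock_freeU; apply/funext => n; rewrite fm1 mul1r. Qed.

Lemma fock_free_gen b phi : fock_free (free_gen b) phi = fock_gen b phi.
Proof. by rewrite fock_freeU; apply/funext => n; rewrite fmU mul1r. Qed.

Lemma fock_free_rel phi : fock_free weyl_rel phi = (fun=> 0).
Proof.
apply/funext => n; rewrite /weyl_rel.
set x := free_gen true; set y := free_gen false.
have e := etrans (fock_freeB (x * y - y * x) 1 phi n)
  (congr1 (fun z => z - _) (fock_freeB (x * y) (y * x) phi n)).
have eM b c : fock_free (free_gen b * free_gen c) phi n
    = fock_gen b (fock_gen c phi) n.
  by rewrite fock_freeM !fock_free_gen.
have e1 : fock_free 1 phi n = phi n by rewrite fock_free1.
apply: (etrans e) => {e}.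
apply: (etrans (congr2 +%R (congr2 (fun z t => z - t) (eM true false)
  (eM false true)) (congr1 -%R e1))) => {eM e1 x y} /=.
have sq m : (Num.sqrt m%:R : R)%:C * (Num.sqrt m%:R : R)%:C = m%:R :> C.
  by rewrite -rmorphM -expr2 sqr_sqrtr ?ler0n// rmorph_nat.
rewrite mulrA sq; case: n => [|n] /=.
  by rewrite sqrtr0 !mul0r subr0 mul1r subrr.
by rewrite mulrA sq -mulrBl -natrB// subSnn mul1r subrr.
Qed.

Lemma fock_free0 x : fock_free x (fun=> 0) = (fun=> 0).
Proof.
by apply/funext => n; rewrite /fock_free big1// => w _; rewrite fock_word0 mulr0.
Qed.

Lemma fock_ideal x phi : x \in weyl_ideal -> fock_free x phi = (fun=> 0).
Proof.
move=> /ideal2P[s ->]; apply/funext => n; rewrite fock_free_sum big1// => uv _.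
by rewrite !fock_freeM fock_free_rel fock_free0.
Qed.

(* The involution on words reverses the order and exchanges the two letters. *)
Definition star_word (w : {fmonom bool}) : {fmonom bool} :=
  FMonom (rev (map negb w)).

Definition star_free (x : F) : F :=
  \sum_(w <- msupp x) << (x@_w)^* *g star_word w >>.

Lemma star_wordM v w : star_word (mmul v w) = mmul (star_word w) (star_word v).
Proof. by apply/val_inj; rewrite /= !fmM /= map_cat rev_cat. Qed.

Lemma star_wordK : involutive star_word.
Proof.
by move=> w; apply/val_inj; rewrite /= map_rev revK -map_comp map_id_in// => b _; exact: negbK.
Qed.

Lemma star_freeEw (E : {fset {fmonom bool}}) x : (msupp x `<=` E)%fset ->
  star_free x = \sum_(w <- E) << (x@_w)^* *g star_word w >>.
Proof.
move=> le; rewrite [LHS](big_fset_incl _ le)// => w _ /mcoeff_outdom ->.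
by rewrite rmorph0 monalgU0.
Qed.

Lemma star_freeU c w : star_free << c *g w >> = << c^* *g star_word w >>.
Proof. by rewrite (star_freeEw (msuppU_le)) big_seq_fset1 mcoeffUU. Qed.

Lemma star_freeB x y : star_free (x - y) = star_free x - star_free y.
Proof.
pose E := (msupp x `|` msupp y)%fset.
rewrite (star_freeEw (E := E)) ?msuppB_le//.
rewrite (star_freeEw (fsubsetUl _ _ : msupp x `<=` E)%fset).
rewrite (star_freeEw (fsubsetUr _ _ : msupp y `<=` E)%fset).
by rewrite -sumrB; apply: eq_bigr => w _; rewrite mcoeffB rmorphB /= monalgUB.
Qed.
HB.instance Definition _ := GRing.isZmodMorphism.Build F F star_free star_freeB.

Lemma star_freeZ c x : star_free (c *: x) = c^* *: star_free x.
Proof.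
rewrite malgZ_def /fgscale raddf_sum /star_free scaler_sumr; apply: eq_bigr => w _ /=.
by rewrite star_freeU rmorphM -mul_malgC malgM_def fgmulUU mul1m.
Qed.

Lemma star_freeM x y : star_free (x * y) = star_free y * star_free x.
Proof.
rewrite malgME raddf_sum /= [X in _ * X]/star_free mulr_sumr; apply: eq_bigr => v _.
rewrite raddf_sum /= /(star_free y) mulr_suml; apply: eq_bigr => w _.
rewrite star_freeU star_wordM rmorphM mulrC.
by rewrite malgM_def fgmulUU.
Qed.

Lemma star_free_gen b : star_free (free_gen b) = free_gen (~~ b).
Proof.
rewrite star_freeU rmorph1; congr << _ >>.
by apply/val_inj; rewrite /= !fmU.
Qed.

Lemma star_free1 : star_free 1 = 1.
Proof.
rewrite star_freeU rmorph1; congr << _ >>.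
by apply/val_inj; rewrite /= !fm1.
Qed.

Lemma star_freeK : involutive star_free.
Proof.
move=> x; rewrite [star_free x]/star_free raddf_sum /=.
rewrite [RHS]monalgE; apply: eq_bigr => w _.
by rewrite star_freeU star_wordK conjCK.
Qed.

Lemma star_free_rel : star_free weyl_rel = weyl_rel.
Proof. set x := free_gen true; set y := free_gen false.
have e := etrans (star_freeB (x * y - y * x) 1)
  (congr1 (fun z => z - _) (star_freeB (x * y) (y * x))).
have eM b c : star_free (free_gen b * free_gen c)
    = free_gen (~~ c) * free_gen (~~ b).
  by rewrite star_freeM !star_free_gen.
apply: (etrans e); exact: (congr2 +%R (congr2 (fun z t => z - t) (eM true false)
  (eM false true)) (congr1 -%R star_free1)).
Qed.

Lemma star_ideal x : x \in weyl_ideal -> star_free x \in weyl_ideal.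
Proof.
move=> /ideal2P[s ->]; rewrite raddf_sum rpred_sum// => uv _ /=.
rewrite star_freeM (star_freeM uv.1) star_free_rel.
by apply: ideal2Ml; apply: ideal2Mr; exact: ideal2_gen.
Qed.

Definition weyl : Type := Quotient.quot weyl_ideal.
HB.instance Definition _ := Choice.on weyl.
HB.instance Definition _ := GRing.Zmodule.on weyl.

Definition weyl_pi (x : F) : weyl := \pi_(Quotient.quot weyl_ideal)%qT x.
Definition weyl_repr (u : weyl) : F := repr (u : Quotient.quot weyl_ideal).

Lemma weyl_reprK : cancel weyl_repr weyl_pi.
Proof. exact: reprK. Qed.

Lemma weyl_piP x y : weyl_pi x = weyl_pi y <-> x - y \in weyl_ideal.
Proof.
by rewrite Quotient.idealrBE; split=> [/eqP|/eqP].
Qed.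

Lemma weyl_piB : {morph weyl_pi : x y / x - y}.
Proof. exact: raddfB. Qed.
HB.instance Definition _ := GRing.isZmodMorphism.Build F weyl weyl_pi weyl_piB.

Lemma weyl_pi_ind (P : weyl -> Prop) : (forall x, P (weyl_pi x)) -> forall u, P u.
Proof. by move=> Pp u; rewrite -[u]weyl_reprK. Qed.

Lemma weyl_reprE x : weyl_repr (weyl_pi x) - x \in weyl_ideal.
Proof. by apply/weyl_piP; rewrite weyl_reprK. Qed.

(* The operations are locked so that unification does not unfold them. *)
Fact weyl_key : unit. Proof. exact: tt. Qed.
Definition weyl_one : weyl := locked_with weyl_key (weyl_pi 1).
Definition weyl_mul : weyl -> weyl -> weyl :=
  locked_with weyl_key (fun u v => weyl_pi (weyl_repr u * weyl_repr v)).
Definition weyl_scale : C -> weyl -> weyl :=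
  locked_with weyl_key (fun c u => weyl_pi (c *: weyl_repr u)).

Lemma weyl_oneE : weyl_one = weyl_pi 1.
Proof. by rewrite /weyl_one unlock. Qed.

Lemma weyl_mulE x y : weyl_mul (weyl_pi x) (weyl_pi y) = weyl_pi (x * y).
Proof.
rewrite /weyl_mul unlock; apply/weyl_piP; set x' := weyl_repr _; set y' := weyl_repr _.
rewrite (_ : _ - _ = x' * (y' - y) + (x' - x) * y).
  by apply: rpredD; [apply: ideal2Ml|apply: ideal2Mr]; exact: weyl_reprE.
by rewrite mulrBr mulrBl addrA subrK.
Qed.

Lemma weyl_scaleE c x : weyl_scale c (weyl_pi x) = weyl_pi (c *: x).
Proof.
rewrite /weyl_scale unlock; apply/weyl_piP; rewrite -scalerBr -mul_malgC.
by apply: ideal2Ml; exact: weyl_reprE.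
Qed.

Lemma weyl_mulA : associative weyl_mul.
Proof.
by elim/weyl_pi_ind=> x; elim/weyl_pi_ind=> y; elim/weyl_pi_ind=> z; rewrite !weyl_mulE mulrA.
Qed.

Lemma weyl_mul1l : left_id weyl_one weyl_mul.
Proof. by elim/weyl_pi_ind=> x; rewrite weyl_oneE weyl_mulE mul1r. Qed.

Lemma weyl_mul1r : right_id weyl_one weyl_mul.
Proof. by elim/weyl_pi_ind=> x; rewrite weyl_oneE weyl_mulE mulr1. Qed.

Lemma weyl_mulDl : left_distributive weyl_mul +%R.
Proof.
elim/weyl_pi_ind=> x; elim/weyl_pi_ind=> y; elim/weyl_pi_ind=> z.
by rewrite -raddfD !weyl_mulE mulrDl raddfD.
Qed.

Lemma weyl_mulDr : right_distributive weyl_mul +%R.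
Proof.
elim/weyl_pi_ind=> x; elim/weyl_pi_ind=> y; elim/weyl_pi_ind=> z.
by rewrite -raddfD !weyl_mulE mulrDr raddfD.
Qed.

Lemma weyl_one_neq0 : weyl_one != 0.
Proof.
apply/eqP; rewrite weyl_oneE -[0](raddf0 weyl_pi) => /weyl_piP; rewrite subr0.
move=> /(@fock_ideal _ (fun=> 1)) /(congr1 (@^~ 0%N)).
by rewrite fock_free1 => /eqP; rewrite oner_eq0.
Qed.

HB.instance Definition _ := GRing.Zmodule_isNzRing.Build weyl
  weyl_mulA weyl_mul1l weyl_mul1r weyl_mulDl weyl_mulDr weyl_one_neq0.

Lemma weyl_scaleA b c u : weyl_scale b (weyl_scale c u) = weyl_scale (b * c) u.
Proof. by elim/weyl_pi_ind: u => x; rewrite !weyl_scaleE scalerA. Qed.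

Lemma weyl_scale1 : left_id 1 weyl_scale.
Proof. by elim/weyl_pi_ind => x; rewrite weyl_scaleE scale1r. Qed.

Lemma weyl_scaleDr : right_distributive weyl_scale +%R.
Proof.
move=> c; elim/weyl_pi_ind => x; elim/weyl_pi_ind => y.
by rewrite -raddfD !weyl_scaleE scalerDr raddfD.
Qed.

Lemma weyl_scaleDl u : {morph weyl_scale^~ u : b c / b + c}.
Proof.
elim/weyl_pi_ind: u => x b c.
by rewrite !weyl_scaleE scalerDl raddfD.
Qed.

HB.instance Definition _ := GRing.Zmodule_isLmodule.Build C weyl
  weyl_scaleA weyl_scale1 weyl_scaleDr weyl_scaleDl.

Lemma weyl_piM x y : weyl_pi (x * y) = weyl_pi x * weyl_pi y.
Proof. by rewrite -weyl_mulE. Qed.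

Lemma weyl_piZ c x : weyl_pi (c *: x) = c *: weyl_pi x.
Proof. by rewrite -weyl_scaleE. Qed.

Lemma weyl_scaleAl (c : C) (u v : weyl) : c *: (u * v) = c *: u * v.
Proof.
elim/weyl_pi_ind: u => x; elim/weyl_pi_ind: v => y.
by rewrite -weyl_piM -!weyl_piZ -weyl_piM scalerAl.
Qed.

HB.instance Definition _ := GRing.Lmodule_isLalgebra.Build C weyl weyl_scaleAl.

Lemma free_algC_comm (c : C) (x : F) : malgC c * x = x * malgC c.
Proof.
rewrite [x]monalgE mulr_sumr mulr_suml; apply: eq_bigr => v _.
apply: (etrans (fgmulUU _ _ _ _)); apply/esym/(etrans (fgmulUU _ _ _ _)).
by rewrite mulm1 mul1m mulrC.
Qed.

Lemma weyl_scaleAr (c : C) (u v : weyl) : c *: (u * v) = u * (c *: v).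
Proof.
elim/weyl_pi_ind: u => x; elim/weyl_pi_ind: v => y.
rewrite -weyl_piM -!weyl_piZ -weyl_piM; congr weyl_pi.
apply: (etrans (esym (mul_malgC c (x * y)))); apply: (etrans (mulrA _ _ _)).
apply: (etrans (congr1 (fun z => z * y) (free_algC_comm c x))).
by apply: (etrans (esym (mulrA _ _ _))); congr (_ * _); exact: mul_malgC.
Qed.

HB.instance Definition _ := GRing.Lalgebra_isAlgebra.Build C weyl weyl_scaleAr.

Definition weyl_a : weyl := weyl_pi (free_gen true).

(* The value does not depend on the representative, see [starE]. *)
Definition star (u : weyl) : weyl := weyl_pi (star_free (weyl_repr u)).

Lemma starE x : star (weyl_pi x) = weyl_pi (star_free x).
Proof. by apply/weyl_piP; rewrite -star_freeB star_ideal// weyl_reprE. Qed.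

Lemma starK : involutive star.
Proof. by elim/weyl_pi_ind => x; rewrite !starE star_freeK. Qed.

Lemma starD : {morph star : u v / u + v}.
Proof.
elim/weyl_pi_ind => x; elim/weyl_pi_ind => y.
by rewrite -raddfD !starE raddfD/= raddfD.
Qed.

Lemma starZ (c : C) u : star (c *: u) = c^* *: star u.
Proof.
by elim/weyl_pi_ind: u => x; rewrite -weyl_piZ !starE star_freeZ weyl_piZ.
Qed.

Lemma starM u v : star (u * v) = star v * star u.
Proof.
elim/weyl_pi_ind: u => x; elim/weyl_pi_ind: v => y.
by rewrite -weyl_piM !starE star_freeM weyl_piM.
Qed.

Lemma star_a : star weyl_a = weyl_pi (free_gen false).
Proof. by rewrite starE star_free_gen. Qed.

Lemma weyl_pi1 : weyl_pi 1 = 1.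
Proof. by rewrite -weyl_oneE. Qed.

Lemma weyl_relation : weyl_a * star weyl_a - star weyl_a * weyl_a = 1.
Proof.
rewrite star_a /weyl_a -!weyl_piM -weyl_piB -weyl_pi1; apply/weyl_piP.
exact: ideal2_gen.
Qed.

Definition weyl_N : weyl := star weyl_a * weyl_a.

Definition weyl_B : set weyl := range (horner_alg weyl_N).

Definition weyl_e (k : int) : weyl :=
  match k with
  | Posz n => weyl_a ^+ n
  | Negz n => star weyl_a ^+ n.+1
  end.

Definition weyl_deg (k : int) : set weyl := [set weyl_e k * b | b in weyl_B].

(* Every element has such a decomposition ([graded_decomp_ex]) and its component
   of degree 0 is unique ([weyl_p_uniq]), whence [weyl_pE]. *)
Definition graded_decomp (u : weyl) (f : int -> weyl) : Prop :=
  [/\ forall k, weyl_deg k (f k), finite_set (f @^-1` [set~ 0])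
    & u = \sum_(k \in [set: int]) f k].

Definition weyl_p (u : weyl) : weyl :=
  xget 0 [set u0 | exists2 f, graded_decomp u f & u0 = f 0].

(* The action of [weyl] on all sequences, through any representative in the free
   algebra (see [fockE]).  Each operator is a finite combination of weighted
   shifts, so it is defined on every sequence; the Fock-Bargmann representation
   is its restriction to [fock_dom] below. *)
Definition fock (u : weyl) (phi : nat -> C) : nat -> C :=
  fock_free (weyl_repr u) phi.

Lemma fockE x phi : fock (weyl_pi x) phi = fock_free x phi.
Proof.
apply/funext => n; apply/eqP; rewrite -subr_eq0 -fock_freeB.
by rewrite (fock_ideal _ (weyl_reprE x)).
Qed.

Lemma fock_a phi n :
  fock weyl_a phi n = (Num.sqrt (n.+1%:R : R))%:C * phi n.+1.
Proof. by rewrite fockE fock_free_gen. Qed.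

Lemma fock_star_a phi n :
  fock (star weyl_a) phi n = (Num.sqrt (n%:R : R))%:C * phi n.-1.
Proof. by rewrite star_a fockE fock_free_gen. Qed.

Definition l2_basis (k n : nat) : C := (n == k)%:R.

Lemma fock_a_basis k : fock weyl_a (l2_basis k) =
  (fun n => (Num.sqrt (k%:R : R))%:C * l2_basis k.-1 n).
Proof.
apply/funext => n; rewrite fock_a /l2_basis; case: k => [|k] /=.
  by rewrite sqrtr0 mulr0 mul0r.
by rewrite eqSS; case: eqVneq => [->|]; rewrite ?mulr0.
Qed.

Lemma fock_star_basis k : fock (star weyl_a) (l2_basis k) =
  (fun n => (Num.sqrt (k.+1%:R : R))%:C * l2_basis k.+1 n).
Proof.
apply/funext => -[|n]; rewrite fock_star_a /l2_basis /=.
  by rewrite sqrtr0 mulr0 mul0r.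
by rewrite eqSS; case: eqVneq => [->|]; rewrite ?mulr0.
Qed.

Lemma fock1 phi : fock 1 phi = phi.
Proof. by rewrite -weyl_pi1 fockE fock_free1. Qed.

Lemma fockM u v phi : fock (u * v) phi = fock u (fock v phi).
Proof.
elim/weyl_pi_ind: u => x; elim/weyl_pi_ind: v => y.
by rewrite -weyl_piM !fockE fock_freeM.
Qed.

Lemma fockB u v phi n : fock (u - v) phi n = fock u phi n - fock v phi n.
Proof.
elim/weyl_pi_ind: u => x; elim/weyl_pi_ind: v => y.
by rewrite -weyl_piB !fockE fock_freeB.
Qed.

Lemma fockZ c u phi n : fock (c *: u) phi n = c * fock u phi n.
Proof.
by elim/weyl_pi_ind: u => x; rewrite -weyl_piZ !fockE fock_freeZ.
Qed.

Lemma fock0 phi n : fock 0 phi n = 0.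
Proof. by rewrite -(subrr 0) fockB subrr. Qed.

Lemma fockD u v phi n : fock (u + v) phi n = fock u phi n + fock v phi n.
Proof. by rewrite -[in RHS](addrK v u) fockB subrK. Qed.

Lemma fock_sum (I : Type) (r : seq I) (f : I -> weyl) phi n :
  fock (\sum_(i <- r) f i) phi n = \sum_(i <- r) fock (f i) phi n.
Proof.
by apply: (big_ind2 (fun u z => fock u phi n = z)) => [|u z v y <- <-|//];
  rewrite ?fock0 ?fockD.
Qed.

Lemma sqrt_natC m : (Num.sqrt m%:R : R)%:C * (Num.sqrt m%:R : R)%:C = m%:R :> C.
Proof. by rewrite -rmorphM -expr2 sqr_sqrtr ?ler0n// rmorph_nat. Qed.

Lemma fock_N phi n : fock weyl_N phi n = n%:R * phi n.
Proof.
rewrite fockM fock_star_a fock_a; case: n => [|n] /=.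
  by rewrite sqrtr0 !mul0r.
by rewrite mulrA sqrt_natC.
Qed.

Lemma fock_B q phi n : fock (horner_alg weyl_N q) phi n = q.[n%:R] * phi n.
Proof.
elim/poly_ind: q phi => [|q c IHq] phi.
  by rewrite rmorph0 fock0 horner0 mul0r.
rewrite rmorphD rmorphM /= horner_algX horner_algC fockD fockM IHq fock_N.
by rewrite fockZ fock1 hornerMXaddC mulrDl mulrA.
Qed.

Lemma fock_deg k u : weyl_deg k u -> k != 0 ->
  forall m, fock u (fun n => (n == m)%:R) m = 0.
Proof.
move=> [_ [q _ <-] <-] k0 m; rewrite fockM.
set phi := fock (horner_alg _ _) _; have -> : phi = (fun n => q.[m%:R] * (n == m)%:R).
  by apply/funext => n; rewrite /phi fock_B; case: eqVneq => [->|]; rewrite ?mulr0.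
case: k k0 => n /= k0.
  have H l (psi : nat -> C) : exists c : C, fock (weyl_a ^+ n) psi l = c * psi (l + n)%N.
    elim: n l psi {k0} => [|n IHn] l psi; first by exists 1; rewrite fock1 addn0 mul1r.
    rewrite exprS fockM fock_a; have [c ->] := IHn l.+1 psi.
    by exists ((Num.sqrt (l.+1%:R : R))%:C * c); rewrite mulrA addnS.
  have [c ->] := H m (fun l => q.[m%:R] * (l == m)%:R).
  have -> : (m + n == m)%N = false; last by rewrite !mulr0.
  by rewrite -[X in _ == X]addn0 eqn_add2l; apply/negbTE.
have H l (psi : nat -> C) : exists c : C, fock (star weyl_a ^+ n) psi l = c * psi (l - n)%N.
  elim: n l psi {k0} => [|n IHn] l psi; first by exists 1; rewrite fock1 subn0 mul1r.
  rewrite exprS fockM fock_star_a; have [c ->] := IHn l.-1 psi.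
  by exists ((Num.sqrt (l%:R : R))%:C * c); rewrite mulrA -subn1 -subnDA.
rewrite exprS fockM fock_star_a {phi}; case: m => [|m]; first by rewrite sqrtr0 mul0r.
have [c ->] := H m (fun l => q.[m.+1%:R] * (l == m.+1)%:R).
have -> : (m - n == m.+1)%N = false; last by rewrite !mulr0.
by apply/negbTE; rewrite neq_ltn ltnS leq_subr.
Qed.

Lemma weyl_p_uniq u f g : graded_decomp u f -> graded_decomp u g -> f 0 = g 0.
Proof.
have main v h q : graded_decomp v h -> h 0 = horner_alg weyl_N q ->
    forall m, fock v (fun n => (n == m)%:R) m = q.[m%:R].
  move=> [hdeg hfin ->] h0 m.
  pose r := undup (0 :: fset_set (h @^-1` [set~ 0])).
  rewrite (fsbigE r) ?undup_uniq//; last first.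
    move=> k _; rewrite mem_undup in_cons negb_or => /andP[_].
    by rewrite in_fset_set// notin_setE /= => /contrapT.
  rewrite (eq_bigl xpredT) => [|k]; last by rewrite in_setT.
  rewrite fock_sum (bigD1_seq 0) ?undup_uniq ?mem_undup ?mem_head//=.
  rewrite h0 fock_B eqxx mulr1 big1 ?addr0// => k k0.
  exact: fock_deg (hdeg k) k0 m.
move=> uf ug.
have deg0 h : graded_decomp u h -> exists q, h 0 = horner_alg weyl_N q.
  by move=> [/(_ 0)[_ [q _ <-] <-] _ _]; exists q; rewrite /= expr0 mul1r.
have [q fq] := deg0 _ uf; have [r gr] := deg0 _ ug.
rewrite fq gr; congr horner_alg; apply/eqP; rewrite -subr_eq0; apply/negPn/negP => qr.
have := max_poly_roots qr (rs := [seq m%:R | m <- iota 0 (size (q - r))]).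
rewrite size_map size_iota ltnn => H; suff: false by []; apply: H.
  apply/allP => _ /mapP[m _ ->]; rewrite /root hornerD hornerN subr_eq0.
  by rewrite -(main _ _ _ uf fq) -(main _ _ _ ug gr).
by rewrite map_inj_uniq ?iota_uniq// => i j /eqP; rewrite eqr_nat => /eqP.
Qed.

Lemma weyl_aN : weyl_N * weyl_a = weyl_a * weyl_N - weyl_a.
Proof.
rewrite /weyl_N mulrA -[X in _ = X - _]addr0 -[in RHS](subrr (star weyl_a * weyl_a * weyl_a)).
rewrite addrCA -mulrBl weyl_relation.
by rewrite mul1r addrK.
Qed.

Lemma weyl_starN : weyl_N * star weyl_a = star weyl_a * weyl_N + star weyl_a.
Proof.
rewrite {1}/weyl_N -mulrA -[X in _ = _ + X]mulr1 -weyl_relation -mulrDr.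
by rewrite /weyl_N addrC subrK.
Qed.

Lemma weyl_aXN n : weyl_N * weyl_a ^+ n = weyl_a ^+ n * (weyl_N - n%:R).
Proof.
elim: n => [|n IHn]; first by rewrite mulr1 mul1r subr0.
rewrite exprS mulrA weyl_aN mulrBl -(mulrA weyl_a weyl_N) IHn.
by rewrite mulrA -[X in _ - X = _]mulr1 -mulrBr -natr1 opprD addrA.
Qed.

Lemma weyl_starXN n :
  weyl_N * star weyl_a ^+ n = star weyl_a ^+ n * (weyl_N + n%:R).
Proof.
elim: n => [|n IHn]; first by rewrite mulr1 mul1r addr0.
rewrite exprS mulrA weyl_starN mulrDl -(mulrA (star weyl_a) weyl_N) IHn.
by rewrite mulrA -[X in _ + X = _]mulr1 -mulrDr -natr1 addrA.
Qed.

Lemma weyl_a_deg k u : weyl_deg k u -> weyl_deg (k + 1) (weyl_a * u).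
Proof.
move=> [_ [q _ <-] <-]; case: k => n /=.
  exists (horner_alg weyl_N q); first by exists q.
  have -> : n%:Z + 1 = n.+1 by rewrite -addn1 PoszD.
  by rewrite /= exprS mulrA.
have -> : Negz n + 1 = - n%:Z by rewrite NegzE -addn1 PoszD opprD subrK.
exists ((weyl_N + n%:R + 1) * horner_alg weyl_N q).
  exists (('X + n%:R + 1) * q) => //.
  by rewrite rmorphM !rmorphD /= horner_algX rmorph1 rmorph_nat.
have -> : weyl_e (- n%:Z) = star weyl_a ^+ n by case: n.
rewrite !mulrA; congr (_ * _); rewrite exprS mulrA.
have -> : weyl_a * star weyl_a = weyl_N + 1.
  by rewrite /weyl_N addrC -weyl_relation subrK.
by rewrite mulrDl mul1r weyl_starXN -[X in _ = _ + X]mulr1 -mulrDr.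
Qed.

Lemma weyl_star_deg k u : weyl_deg k u -> weyl_deg (k - 1) (star weyl_a * u).
Proof.
move=> [_ [q _ <-] <-]; case: k => [[|n]|n] /=.
- exists (horner_alg weyl_N q); first by exists q.
  by rewrite sub0r /= expr0 mul1r expr1.
- have -> : n.+1%:Z - 1 = n by rewrite -addn1 PoszD addrK.
  exists ((weyl_N - n%:R) * horner_alg weyl_N q).
    exists (('X - n%:R) * q) => //.
    by rewrite rmorphM !rmorphB /= horner_algX rmorph_nat.
  by rewrite !mulrA; congr (_ * _); rewrite /= -weyl_aXN exprS mulrA.
- have -> : Negz n - 1 = Negz n.+1 by rewrite !NegzE -opprD -PoszD addn1.
  exists (horner_alg weyl_N q); first by exists q.
  by rewrite /= !exprS !mulrA.
Qed.

Definition weyl_graded (u : weyl) := exists2 s : seq (int * weyl),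
  (forall kv, kv \in s -> weyl_deg kv.1 kv.2) & u = \sum_(kv <- s) kv.2.

Lemma weyl_gradedT u : weyl_graded u.
Proof.
have gD u1 u2 : weyl_graded u1 -> weyl_graded u2 -> weyl_graded (u1 + u2).
  move=> [s1 h1 ->] [s2 h2 ->]; exists (s1 ++ s2); last by rewrite big_cat.
  by move=> kv; rewrite mem_cat => /orP[/h1|/h2].
have gZ c v : weyl_graded v -> weyl_graded (c *: v).
  move=> [s hs ->]; exists [seq (kv.1, c *: kv.2) | kv <- s]; last first.
    by rewrite big_map scaler_sumr.
  move=> _ /mapP[kv /hs[_ [q _ <-] <-] ->] /=.
  exists (horner_alg weyl_N (c *: q)); first by exists (c *: q).
  by rewrite linearZ /= mulr_algl scalerAr.
have ga v : weyl_graded v -> weyl_graded (weyl_a * v).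
  move=> [s hs ->]; exists [seq (kv.1 + 1, weyl_a * kv.2) | kv <- s]; last first.
    by rewrite big_map mulr_sumr.
  by move=> _ /mapP[kv /hs h ->]; exact: weyl_a_deg.
have gs v : weyl_graded v -> weyl_graded (star weyl_a * v).
  move=> [s hs ->]; exists [seq (kv.1 - 1, star weyl_a * kv.2) | kv <- s]; last first.
    by rewrite big_map mulr_sumr.
  by move=> _ /mapP[kv /hs h ->]; exact: weyl_star_deg.
elim/weyl_pi_ind: u => x; rewrite [x]monalgE raddf_sum /=.
apply: (big_ind weyl_graded) => //; first by exists [::]; rewrite ?big_nil.
move=> w _; rewrite -[_@_w]mulr1 -[X in << _ *g X >>]mul1m -fgmulUU -malgM_def.
rewrite mul_malgC weyl_piZ; apply: gZ; case: w => w.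
elim: w => [|b w IHw].
  exists [:: (0, 1)]; last by rewrite big_seq1 -fmoneE weyl_pi1.
  move=> kv; rewrite inE => /eqP -> /=; exists 1; last by rewrite mulr1.
  by exists 1; rewrite // rmorph1.
have -> : << FMonom (b :: w) >> = free_gen b * << FMonom w >> :> F.
  rewrite malgM_def fgmulUU mulr1; congr << _ >>.
  by apply/val_inj; rewrite /= fmM fmU.
rewrite weyl_piM; case: b; first exact: ga.
by rewrite -star_a; exact: gs.
Qed.

Lemma graded_decomp_ex u : exists f, graded_decomp u f.
Proof.
have [s hs ->] := weyl_gradedT u.
pose f k := \sum_(kv <- s | kv.1 == k) kv.2.
have f0 k : k \notin undup [seq kv.1 | kv <- s] -> f k = 0.
  rewrite mem_undup => ks; rewrite /f big1_seq// => kv /andP[/eqP kvk kvs].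
  by move/negP: ks; rewrite -kvk map_f.
exists f; split=> [k||].
- rewrite /f big_seq_cond; apply: (big_ind (weyl_deg k)) => [|u1 u2|kv].
  + by exists 0; rewrite ?mulr0//; exists 0; rewrite // rmorph0.
  + move=> [_ [q1 _ <-] <-] [_ [q2 _ <-] <-].
    exists (horner_alg weyl_N (q1 + q2)); first by exists (q1 + q2).
    by rewrite rmorphD mulrDr.
  + by move=> /andP[/hs h /eqP <-].
- apply: (sub_finite_set _ (finite_seq (undup [seq kv.1 | kv <- s]))).
  by move=> k /=; apply: contra_notP => /negP; exact: f0.
- rewrite (fsbigE (undup [seq kv.1 | kv <- s])) ?undup_uniq//; last first.
    by move=> k _; exact: f0.
  rewrite (eq_bigl xpredT) => [|k]; last by rewrite in_setT.
  rewrite /f (exchange_big_dep xpredT)//= big_seq [RHS]big_seq.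
  apply: eq_bigr => kv kvs; rewrite (big_rem kv.1) ?mem_undup ?map_f//= eqxx.
  rewrite big1_seq ?addr0// => k /andP[/eqP <-].
  by rewrite mem_rem_uniq ?undup_uniq// inE eqxx.
Qed.

Lemma weyl_pE u f : graded_decomp u f -> weyl_p u = f 0.
Proof.
move=> uf; rewrite /weyl_p; case: xgetP => [_ _ [g ug ->]|/(_ (f 0))[]].
  exact: weyl_p_uniq ug uf.
by exists f.
Qed.

Definition Ind (P : set weyl) : set weyl :=
  [set x | star x = x /\ forall y, P (weyl_p (star y * x * y))].

(* Positivity of a complex number includes that it is real. *)
Definition Pos_nat : set weyl :=
  [set horner_alg weyl_N f
     | f in [set f : {poly C} | forall k : nat, 0 <= f.[k%:R]]].

(* The case M = 0 is square summability, as 0 ^+ 0 = 1. *)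
Definition fock_dom : set (nat -> C) :=
  [set phi | forall M : nat,
     cvgn (series (fun k => k%:R ^+ M * Normc.normc (phi k) ^+ 2 : R))].

(* [C^o] carries the topology given by the modulus. *)
Definition l2_inner (phi psi : nat -> C) : C :=
  limn (series (fun n => phi n * (psi n)^* : C^o)).

Definition weyl_pos : set weyl :=
  [set x | star x = x /\
           forall phi, fock_dom phi -> 0 <= l2_inner (fock x phi) phi].

End WeylAlgebra.

Arguments Pos_nat : clear implicits.
Arguments fock_dom : clear implicits.
Arguments weyl_pos : clear implicits.

(* Main.v *)
Require Import Defs.
From mathcomp Require Import all_boot all_order all_algebra.
From mathcomp Require Import complex ring lra.
From mathcomp Require Import all_classical all_reals all_analysis.
Set Implicit Arguments. Unset Strict Implicit. Unset Printing Implicit Defensive.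
Import Order.TTheory GRing.Theory Num.Theory.
Import numFieldNormedType.Exports.
Local Open Scope classical_set_scope.
Local Open Scope complex_scope.
Local Open Scope ring_scope.

(** An element x of the Weyl algebra lies in Ind Pos(N_0) exactly when it is
    hermitian and <x phi, phi> >= 0 for every finitely supported phi
    ([Ind_Pos_natP]).  Indeed the degree-0 part of u acts by the diagonal of the
    matrix of u in the basis (e_m) ([weyl_p_diag]), so p (y^* x y) is nonnegative
    on N_0 exactly when all the numbers <y^* x y e_m, e_m> = <x (y e_m), y e_m> are
    nonnegative ([fock_adjoint]); the vectors y e_m are finitely supported, and
    already y e_0 ranges over all such vectors, because e_0 is cyclic for the
    powers of a^* ([finsupp_vacuum]).

    Since finitely supported vectors belong to the Fock-Bargmann domain, one
    inclusion follows at once.  The other one asks that positivity pass from the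
    truncations phi_K of a rapidly decreasing sequence phi to phi itself
    ([fock_dom_ge0]).  Write S_K for the K-th partial sum of the series defining
    <x phi, phi>, and T_K = <x phi_K, phi_K> >= 0.  Every x is continuous on
    rapidly decreasing sequences: it maps families that are bounded for all the
    polynomially weighted sup norms to such families ([schwartz_bounded_fock]).
    The sequences (K + 1)^2 (phi - phi_K) form such a family, whence
    S_K - T_K = O(1 / (K + 1)), and the limit of S_K is nonnegative
    ([series_ge0]). *)

Section FockPositivity.
Variable R : realType.
Local Notation C := (R[i]).
Local Notation W := (weyl R).
Local Notation a := (weyl_a R).
Implicit Types (u v x y : W) (phi psi : nat -> C).

(** * The action on finitely supported sequences *)

(** The linear span of 1 is enlarged to the whole algebra by multiplication by
    the two generators on the left; this reduces statements on the action of
    the algebra to the two weighted shifts. *)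
Lemma weyl_gen_ind (P : W -> Prop) :
  P 1 -> (forall c u v, P u -> P v -> P (c *: u + v)) ->
  (forall u, P u -> P (a * u)) -> (forall u, P u -> P (star a * u)) ->
  forall u, P u.
Proof.
move=> P1 PL Pa Ps u.
have P0 : P 0 by rewrite -(subrr (1 : W)) addrC -scaleN1r; exact: PL.
have [s hs ->] := weyl_gradedT u.
rewrite big_seq; apply: big_ind => // [v w Pv Pw|kv /hs [_ [q _ <-] <-]].
  by rewrite -[v]scale1r; exact: PL.
have Pq : P (horner_alg (weyl_N R) q).
  elim/poly_ind: q => [|q c IHq]; first by rewrite rmorph0.
  rewrite mulrC rmorphD rmorphM /= horner_algX horner_algC addrC; apply: PL => //.
  by rewrite /weyl_N -mulrA; apply/Ps/Pa.
case: kv.1 => n /=.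
  by elim: n => [|n IHn]; rewrite ?mul1r// exprS -mulrA; exact: Pa.
by elim: n.+1 => [|m IHm]; rewrite ?mul1r// exprS -mulrA; exact: Ps.
Qed.

Lemma fockP c u v phi : fock (c *: u + v) phi =
  (fun n => c * fock u phi n + fock v phi n).
Proof. by apply/funext => n; rewrite fockD fockZ. Qed.

Lemma fock_gen_aE : fock a = fock_gen true.
Proof. by apply/funext => phi; apply/funext => n; rewrite fock_a. Qed.

Lemma fock_gen_starE : fock (star a) = fock_gen false.
Proof. by apply/funext => phi; apply/funext => n; rewrite fock_star_a. Qed.

Lemma fock_linear u c phi psi : fock u (fun n => c * phi n + psi n) =
  (fun n => c * fock u phi n + fock u psi n).
Proof.
elim/weyl_gen_ind: u => [|d u v IHu IHv|u IHu|u IHu].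
- by rewrite !fock1.
- rewrite !fockP IHu IHv; apply/funext => n.
  by rewrite !mulrDr mulrCA !addrA; congr (_ + _); rewrite addrAC.
- by rewrite !fockM IHu fock_gen_aE fock_genE.
- by rewrite !fockM IHu fock_gen_starE fock_genE.
Qed.

Definition finsupp phi := exists N, forall n, (N <= n)%N -> phi n = 0.

Lemma finsupp_basis m : finsupp (@l2_basis R m).
Proof. by exists m.+1 => n mn; rewrite /l2_basis gtn_eqF. Qed.

Lemma finsupp_common c phi psi : finsupp phi -> finsupp psi ->
  exists N, [/\ forall n, (N <= n)%N -> phi n = 0,
    forall n, (N <= n)%N -> psi n = 0 &
    forall n, (N <= n)%N -> c * phi n + psi n = 0].
Proof.
move=> [N hN] [M hM]; exists (maxn N M).
split=> n; rewrite geq_max => /andP[Nn Mn]; rewrite ?(hN _ Nn) ?(hM _ Mn)//.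
by rewrite mulr0 addr0.
Qed.

Lemma finsupp_fock u phi : finsupp phi -> finsupp (fock u phi).
Proof.
move=> fphi; elim/weyl_gen_ind: u => [|c u v fu fv|u [N hN]|u [N hN]].
- by rewrite fock1.
- by rewrite fockP; have [N [_ _ hN]] := finsupp_common c fu fv; exists N.
- by exists N => n Nn; rewrite fockM fock_a hN ?mulr0// leqW.
- by exists N.+1 => -[//|n] Nn; rewrite fockM fock_star_a hN ?mulr0.
Qed.

Lemma finsupp_fock_dom phi : finsupp phi -> fock_dom R phi.
Proof.
move=> [N hN] M; apply: (is_cvg_near_cst
  (series (fun k => k%:R ^+ M * Normc.normc (phi k) ^+ 2 : R) N)).
near=> n; have Nn : (N <= n)%N by near: n; exact: nbhs_infty_ge.
apply/eqP; rewrite -subr_eq0 sub_series_geq// big_nat_cond big1// => i.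
by rewrite andbT => /andP[Ni _]; rewrite hN// Normc.normc0 expr0n mulr0.
Unshelve. all: by end_near. Qed.

Lemma l2_innerE N phi psi : (forall n, (N <= n)%N -> phi n * (psi n)^* = 0) ->
  l2_inner phi psi = \sum_(n < N) phi n * (psi n)^*.
Proof.
move=> hN; rewrite -(big_mkord xpredT (fun n => phi n * (psi n)^*)).
rewrite /l2_inner; apply: (lim_near_cst (@norm_hausdorff _ C^o)); near=> n.
have Nn : (N <= n)%N by near: n; exact: nbhs_infty_ge.
apply/eqP; rewrite -subr_eq0.
rewrite (sub_series_geq (fun n => phi n * (psi n)^* : C^o) Nn).
by rewrite big_nat_cond big1// => i; rewrite andbT => /andP[/hN].
Unshelve. all: by end_near. Qed.

Lemma l2_innerEl N phi psi : (forall n, (N <= n)%N -> phi n = 0) ->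
  l2_inner phi psi = \sum_(n < N) phi n * (psi n)^*.
Proof. by move=> phiN; apply: l2_innerE => n /phiN ->; rewrite mul0r. Qed.

Lemma l2_inner_basisr phi m : l2_inner phi (l2_basis R m) = phi m.
Proof.
rewrite (@l2_innerE m.+1) => [|n mn]; last first.
  by rewrite /l2_basis gtn_eqF// rmorph0 mulr0.
rewrite big_ord_recr /= /l2_basis eqxx rmorph1 mulr1 big1 ?add0r// => i _.
by rewrite ltn_eqF// rmorph0 mulr0.
Qed.

Lemma conj_real (r : R) : (r%:C : C)^* = r%:C.
Proof. by apply/eqP; rewrite eq_complex /= oppr0 !eqxx. Qed.

Lemma l2_inner_linearl c phi1 phi2 psi : finsupp phi1 -> finsupp phi2 ->
  l2_inner (fun n => c * phi1 n + phi2 n) psi =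
  c * l2_inner phi1 psi + l2_inner phi2 psi.
Proof.
move=> f1 f2; have [N [h1 h2 h]] := finsupp_common c f1 f2.
rewrite !(@l2_innerEl N)// mulr_sumr -big_split /=.
by apply: eq_bigr => i _; rewrite mulrDl mulrA.
Qed.

Lemma l2_inner_linearr c phi psi1 psi2 : finsupp phi ->
  l2_inner phi (fun n => c * psi1 n + psi2 n) =
  c^* * l2_inner phi psi1 + l2_inner phi psi2.
Proof.
move=> [N hN]; rewrite !(@l2_innerEl N)// mulr_sumr -big_split /=.
by apply: eq_bigr => i _; rewrite rmorphD rmorphM mulrDr mulrCA.
Qed.

(** The two weighted shifts are mutually adjoint by a change of index; finite
    support of phi kills the boundary term of the shifted sum. *)
Lemma fock_adjoint u phi psi : finsupp phi ->
  l2_inner (fock u phi) psi = l2_inner phi (fock (star u) psi).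
Proof.
elim/weyl_gen_ind: u phi psi => [|c u v IHu IHv|u IHu|u IHu] phi psi fphi.
- by rewrite -weyl_pi1 starE star_free1 weyl_pi1 !fock1.
- rewrite starD starZ !fockP l2_inner_linearl ?l2_inner_linearr ?IHu ?IHv//.
  + by rewrite conjCK.
  + exact: finsupp_fock.
  + exact: finsupp_fock.
- rewrite starM !fockM -IHu//; have [N hN] := finsupp_fock u fphi.
  rewrite (@l2_innerE N) => [|n Nn]; last first.
    by rewrite fock_a hN ?mulr0 ?mul0r// leqW.
  rewrite (@l2_innerE N.+1) => [|n Nn]; last by rewrite hN ?mul0r// ltnW.
  rewrite big_ord_recl /= fock_star_a /= sqrtr0 mul0r rmorph0 mulr0 add0r.
  apply: eq_bigr => i _; rewrite fock_star_a fock_a /= rmorphM /= conj_real.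
  by rewrite mulrCA mulrA.
- rewrite starM !fockM -IHu// starK; have [N hN] := finsupp_fock u fphi.
  rewrite (@l2_innerE N.+1) => [|[//|n] Nn]; last first.
    by rewrite fock_star_a hN ?mulr0 ?mul0r.
  rewrite (@l2_innerE N) => [|n Nn]; last by rewrite hN ?mul0r.
  rewrite big_ord_recl /= fock_star_a /= sqrtr0 !mul0r add0r.
  apply: eq_bigr => i _; rewrite fock_star_a fock_a /= rmorphM /= conj_real.
  by rewrite mulrCA mulrA.
Qed.

(** The vacuum e_0 is cyclic: e_(m+1) = (m + 1)^(-1/2) a^* e_m. *)
Lemma finsupp_vacuum phi : finsupp phi -> exists y, fock y (l2_basis R 0) = phi.
Proof.
have basis m : exists y, fock y (l2_basis R 0) = l2_basis R m.
  elim: m => [|m [y hy]]; first by exists 1; rewrite fock1.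
  exists ((Num.sqrt (m.+1%:R : R))%:C^-1 *: (star a * y)).
  apply/funext => n; rewrite fockZ fockM hy fock_star_basis mulrA mulVf ?mul1r//.
  by rewrite eq_complex /= eqxx andbT gt_eqF// sqrtr_gt0 ltr0n.
move=> [N]; elim: N phi => [|N IHN] phi hN.
  by exists 0; apply/funext => n; rewrite fock0 hN.
have [z hz] := basis N.
have [|y hy] := IHN (fun n => if n == N then 0 else phi n).
  by move=> n; rewrite leq_eqVlt eq_sym; case: eqVneq => //= _; exact: hN.
exists (phi N *: z + y); apply/funext => n.
rewrite fockD fockZ hz hy /l2_basis; case: eqVneq => [->|_].
  by rewrite mulr1 addr0.
by rewrite mulr0 add0r.
Qed.

(** * The projection and induced positivity *)

(** Components of nonzero degree move e_m to a multiple of another basis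
    vector, so only the component of degree 0 contributes to the diagonal. *)
Lemma weyl_p_diag u m :
  fock (weyl_p u) (l2_basis R m) m = fock u (l2_basis R m) m.
Proof.
have [h uh] := graded_decomp_ex u; rewrite (weyl_pE uh).
move: uh => [hdeg /finite_seqP[s hs] ->].
rewrite (fsbigE (undup (0 :: s))) ?undup_uniq//; last first.
  move=> k _; rewrite mem_undup in_cons negb_or => /andP[_ /negP ks].
  by apply: contrapT => hk0; apply: ks; have : [set` s] k by rewrite -hs.
rewrite (eq_bigl xpredT) => [|k]; last by rewrite in_setT.
rewrite fock_sum (bigD1_seq 0) ?undup_uniq ?mem_undup ?mem_head//=.
rewrite big1 ?addr0// => k k0; exact: fock_deg (hdeg k) k0 m.
Qed.

Lemma weyl_p_B u : exists q, weyl_p u = horner_alg (weyl_N R) q.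
Proof.
have [h uh] := graded_decomp_ex u; rewrite (weyl_pE uh).
by case: uh => /(_ 0)[_ [q _ <-] <-] _ _; exists q; rewrite /= mul1r.
Qed.

Lemma Pos_nat_p u : Pos_nat R (weyl_p u) <->
  forall m, 0 <= fock u (l2_basis R m) m.
Proof.
have B q m : fock (horner_alg (weyl_N R) q) (l2_basis R m) m = q.[m%:R].
  by rewrite fock_B /l2_basis eqxx mulr1.
split=> [[q q0 qp] m|u0]; first by rewrite -weyl_p_diag -qp B.
have [q qp] := weyl_p_B u; exists q => // m.
by rewrite -B -qp weyl_p_diag.
Qed.

(** Conjugation by y tests x on the vectors y e_m, which exhaust the finitely
    supported ones. *)
Lemma Ind_Pos_natP x : Ind (Pos_nat R) x <->
  star x = x /\ forall phi, finsupp phi -> 0 <= l2_inner (fock x phi) phi.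
Proof.
have E y m : fock (star y * x * y) (l2_basis R m) m =
    l2_inner (fock x (fock y (l2_basis R m))) (fock y (l2_basis R m)).
  rewrite -mulrA fockM -l2_inner_basisr fock_adjoint ?starK ?fockM//.
  by do !apply: finsupp_fock; exact: finsupp_basis.
split=> -[xx xpos]; split=> //; [move=> phi fphi|move=> y].
  have [y <-] := finsupp_vacuum fphi; rewrite -E.
  by have /Pos_nat_p := xpos y; apply.
apply/Pos_nat_p => m; rewrite E; apply: xpos.
by apply: finsupp_fock; exact: finsupp_basis.
Qed.

(** * Limits of complex series *)

Local Notation Re := complex.Re.
Local Notation Im := complex.Im.

Lemma cvg_ReIm (s : nat -> C) (l : C) :
  (fun n => Re (s n)) @ \oo --> Re l -> (fun n => Im (s n)) @ \oo --> Im l ->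
  (s : nat -> C^o) @ \oo --> (l : C^o).
Proof.
move=> /cvgrPdist_le sRe /cvgrPdist_le sIm; apply/cvgrPdist_le => e e0.
have eR : e = (Re e)%:C by rewrite RRe_real// gtr0_real.
have e20 : 0 < Re e / 2 by rewrite divr_gt0//; move: e0; rewrite ltcE => /andP[].
near=> n; set d : C := l - s n.
rewrite eR -[d]/(l - s n); apply: (@le_trans _ _ (`|Re d|%:C + `|Im d|%:C)).
  rewrite [X in `|X|](complexE d) (le_trans (ler_normD _ _))//.
  rewrite normrM !normc_def /= !expr0n /= !addr0 add0r expr1n sqrtr1 mul1r.
  by rewrite !sqrtr_sqr.
rewrite -rmorphD lecR (splitr (Re e)) lerD//.
  have -> : Re d = Re l - Re (s n) by rewrite /d; case: (l) (s n) => ? ? [].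
  by near: n; exact: sRe.
have -> : Im d = Im l - Im (s n) by rewrite /d; case: (l) (s n) => ? ? [].
by near: n; exact: sIm.
Unshelve. all: by end_near. Qed.

Lemma is_cvg_series_inv_sqr : cvgn (series (fun n => (n.+1%:R ^+ 2)^-1 : R)).
Proof.
apply: nondecreasing_is_cvgn.
  by apply: nondecreasing_series => n _ _; rewrite invr_ge0 exprn_ge0.
(* The bound on partial sums is 2 - 1 / m, by telescoping
   1 / (m + 1)^2 <= 1 / m - 1 / (m + 1) after the first term. *)
exists 2 => _ [n _ <-].
suff H m : series (fun n => (n.+1%:R ^+ 2)^-1 : R) m.+1 <= 2 - m.+1%:R^-1.
  case: n => [|n]; first by rewrite /series /= big_geq.
  by rewrite (le_trans (H n))// gerBl invr_ge0.
elim: m => [|m IHm].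
  by rewrite seriesSr /series /= big_geq// add0r expr1n invr1; lra.
rewrite seriesSr (le_trans (lerD IHm (lexx _)))//.
have m1 : 0 < m.+1%:R :> R by rewrite ltr0n.
rewrite -(natr1 m.+1); set t : R := m.+1%:R in m1 *.
rewrite -subr_ge0.
have -> : 2 - (t + 1)^-1 - (2 - t^-1 + ((t + 1) ^+ 2)^-1) = (t * (t + 1) ^+ 2)^-1.
  by field; apply/andP; split; lra.
by rewrite invr_ge0 mulr_ge0 ?exprn_ge0//; lra.
Qed.

Lemma Re_series (z : nat -> C) n : Re (series z n) = series (fun k => Re (z k)) n.
Proof. exact: (raddf_sum (@Re R : Rcomplex R -> R)). Qed.

Lemma Im_series (z : nat -> C) n : Im (series z n) = series (fun k => Im (z k)) n.
Proof. exact: (raddf_sum (@Im R : Rcomplex R -> R)). Qed.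

Lemma normr_le_ReIm (z : C) (r : R) :
  `|z| <= r%:C -> `|Re z| <= r /\ `|Im z| <= r.
Proof.
move=> zr; split; rewrite -lecR (le_trans _ zr) ?normc_ge_Re//.
by rewrite normc_def lecR -sqrtr_sqr ler_wsqrtr// lerDr sqr_ge0.
Qed.

(** The first bound makes the real parts absolutely summable.  By the second
    one the imaginary parts of the partial sums tend to 0, and their real parts
    are bounded below by a sequence tending to 0. *)
Lemma series_ge0 (z : nat -> C) (A B : C) :
  (forall n, n.+1%:R ^+ 2 * `|z n| <= A) ->
  (forall K, exists2 T, 0 <= T & K.+1%:R * `|series z K - T| <= B) ->
  0 <= limn (series (z : nat -> C^o)).
Proof.
move=> zA zB.
have AR : A = (Re A)%:C.
  by rewrite RRe_real// ger0_real// (le_trans _ (zA 0%N))// pmulr_rge0// exprn_gt0.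
have BR : B = (Re B)%:C.
  have [T _ TB] := zB 0%N.
  by rewrite RRe_real// ger0_real// (le_trans _ TB)// pmulr_rge0.
have natC (n : nat) : n%:R = (n%:R : R)%:C by rewrite rmorph_nat.
have cRe : cvgn (series (fun n => Re (z n))).
  apply: normed_cvg.
  apply: (series_le_cvg (v_ := fun n => Re A * (n.+1%:R ^+ 2)^-1)) => [n|n|n|].
  - exact: normr_ge0.
  - rewrite /= mulr_ge0 ?invr_ge0 ?exprn_ge0// -lecR -AR.
    by rewrite (le_trans _ (zA 0%N))// pmulr_rge0// exprn_gt0.
  - have n0 : 0 < n.+1%:R ^+ 2 :> R by rewrite exprn_gt0.
    suff /normr_le_ReIm[] : `|z n| <= (Re A / n.+1%:R ^+ 2)%:C by [].
    rewrite rmorphM /= fmorphV rmorphXn /= -natC -AR ler_pdivlMr.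
      by rewrite mulrC.
    by rewrite exprn_gt0.
  - by have := @is_cvg_seriesZ R _ (Re A) is_cvg_series_inv_sqr.
have key K : `|Im (series z K)| <= Re B * harmonic K /\
    - (Re B * harmonic K) <= Re (series z K).
  have [T T0 TB] := zB K.
  have : `|series z K - T| <= (Re B * harmonic K)%:C.
    rewrite rmorphM /= fmorphV /= -natC -BR ler_pdivlMr//.
    by rewrite mulrC.
  move=> /normr_le_ReIm[].
  have -> : Re (series z K - T) = Re (series z K) - Re T.
    by case: (series z K) (T) => ? ? [].
  have -> : Im (series z K - T) = Im (series z K) - Im T.
    by case: (series z K) (T) => ? ? [].
  move: T0; rewrite lecE => /andP[/eqP -> /= ReT].
  rewrite subr0 ler_norml => /andP[h _] ->; split=> //.
  by rewrite (le_trans h)// gerBl.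
have hB : (fun K => Re B * harmonic K) @ \oo --> (0 : R).
  by rewrite -[X in _ --> X](mulr0 (Re B)); apply: cvgMr; exact: cvg_harmonic.
pose L := limn (series (fun n => Re (z n))).
have L0 : 0 <= L.
  have hL : (fun K => Re (series z K) + Re B * harmonic K) @ \oo --> L.
    rewrite -[L]addr0; apply: cvgD => //.
    by under eq_fun do rewrite Re_series.
  rewrite -(cvg_lim (@Rhausdorff R) hL); apply: limr_ge.
    by apply/cvg_ex; exists L.
  by apply: nearW => K; rewrite -lerBlDr sub0r; have [] := key K.
have -> : limn (series (z : nat -> C^o)) = L%:C; last by rewrite ler0c.
apply: (cvg_lim (@norm_hausdorff _ C^o)); apply: cvg_ReIm => /=.
  by under eq_fun do rewrite Re_series.
apply: (@squeeze_cvgr _ _ _ _ (fun K => - (Re B * harmonic K))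
  (fun K => Re B * harmonic K)) => //.
  by apply: nearW => K; rewrite -ler_norml; have [] := key K.
by rewrite -oppr0; exact: cvgN.
Qed.

(** * From finitely supported to rapidly decreasing sequences *)

(** Boundedness of a family in the Frechet space of rapidly decreasing
    sequences; the weights n + 1 also control the term of index 0. *)
Definition schwartz_bounded (I : Type) (psi : I -> nat -> C) :=
  forall M, exists A, forall i n, n.+1%:R ^+ M * `|psi i n| <= A.

Lemma ler_nat_double (K : numDomainType) n : n.+2%:R <= 2 * n.+1%:R :> K.
Proof. by rewrite -natrM ler_nat mul2n -addnn addSnnS leq_addl. Qed.

Lemma normc_sqrt_le n : `|(Num.sqrt (n%:R : R))%:C| <= n.+1%:R :> C.
Proof.
rewrite ger0_norm ?ler0c ?sqrtr_ge0// -(rmorph_nat (real_complex R)) lecR.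
rewrite -[leRHS]ger0_norm// -sqrtr_sqr ler_wsqrtr//.
by rewrite -natrX ler_nat (leq_trans (leqnSn n))// -[leqLHS]expn1 leq_pexp2l.
Qed.

(** Each weighted shift costs one power of the weight, because sqrt n <= n + 1,
    and a shift to the right another factor at most 2 per power. *)
Lemma schwartz_bounded_fock (I : Type) u (psi : I -> nat -> C) :
  schwartz_bounded psi -> schwartz_bounded (fun i => fock u (psi i)).
Proof.
move=> bpsi; elim/weyl_gen_ind: u => [|c u v IHu IHv|u IHu|u IHu] M.
- by have [A hA] := bpsi M; exists A => i n; rewrite fock1.
- have [A hA] := IHu M; have [B hB] := IHv M; exists (`|c| * A + B) => i n.
  rewrite fockP (le_trans _ (lerD (ler_wpM2l (normr_ge0 c) (hA i n)) (hB i n)))//.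
  rewrite mulrCA -mulrDr ler_wpM2l ?exprn_ge0//.
  by rewrite (le_trans (ler_normD _ _))// normrM.
- have [A hA] := IHu M.+1; exists A => i n.
  rewrite fockM fock_a normrM (le_trans _ (hA i n.+1))// mulrA.
  rewrite ler_wpM2r// exprSr ler_pM ?exprn_ge0//; last exact: normc_sqrt_le.
  by rewrite lerXn2r ?nnegrE// ler_nat.
- have [A hA] := IHu M.+1; exists (2 ^+ M.+1 * A) => i [|n].
    rewrite fockM fock_star_a sqrtr0 mul0r normr0 mulr0 mulr_ge0 ?exprn_ge0//.
    by rewrite (le_trans _ (hA i 0%N))// mulr_ge0 ?exprn_ge0.
  have h2 : 0 <= 2 ^+ M.+1 :> C by rewrite exprn_ge0.
  rewrite fockM fock_star_a normrM (le_trans _ (ler_wpM2l h2 (hA i n)))//=.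
  rewrite !mulrA ler_wpM2r// -exprMn [leRHS]exprSr ler_pM ?exprn_ge0//.
    by rewrite lerXn2r ?nnegrE ?mulr_ge0// ler_nat_double.
  by rewrite (le_trans (normc_sqrt_le _))// ler_nat_double.
Qed.

(** The terms of a convergent series are bounded. *)
Lemma fock_dom_bounded phi :
  fock_dom R phi -> schwartz_bounded (fun _ : unit => phi).
Proof.
move=> dphi M.
have [B hB] : exists B : R,
    forall k, k%:R ^+ M.*2 * Normc.normc (phi k) ^+ 2 <= B.
  have /cvg_series_cvg_0/cvgP/cvg_seq_bounded := dphi M.*2.
  move=> /bounded_fun_has_ubound[B hB].
  by exists B => k; apply: hB; exists k.
have nE k : `|phi k| = (Normc.normc (phi k))%:C by [].
have B0 : 0 <= B by apply: le_trans (hB 0%N); rewrite mulr_ge0 ?sqr_ge0 ?exprn_ge0.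
have n0 k : 0 <= Normc.normc (phi k) by case: (phi k) => r s; exact: sqrtr_ge0.
have hB1 k : k%:R ^+ M * Normc.normc (phi k) <= 1 + B.
  rewrite -ler_sqr ?nnegrE ?mulr_ge0 ?exprn_ge0 ?addr_ge0//.
  rewrite exprMn -exprM muln2 (le_trans (hB k))//.
  by rewrite sqrrD expr1n mul1r; nra.
exists (2 ^+ M * (1 + B) + Normc.normc (phi 0%N))%:C => -[] n.
rewrite nE -(rmorph_nat (real_complex R)) -rmorphXn -rmorphM lecR.
case: n => [|n].
  by rewrite expr1n mul1r lerDr mulr_ge0 ?exprn_ge0// addr_ge0.
have h2 : 0 <= 2 ^+ M :> R by rewrite exprn_ge0.
apply: ler_wpDr => //; apply: le_trans (ler_wpM2l h2 (hB1 n.+1)).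
by rewrite mulrA ler_wpM2r// -exprMn lerXn2r ?nnegrE ?mulr_ge0// ler_nat_double.
Qed.

(** The partial sums of <u phi, phi> differ from <u psi, psi>, for psi the
    truncation of phi at the same index, by a quantity tending to 0. *)
Lemma fock_dom_ge0 u phi : fock_dom R phi ->
  (forall psi, finsupp psi -> 0 <= l2_inner (fock u psi) psi) ->
  0 <= l2_inner (fock u phi) phi.
Proof.
move=> dphi upos; have bphi := fock_dom_bounded dphi.
(* With the factor (K + 1)^2, each of the K terms of the difference is
   O(1 / (K + 1)^2). *)
pose tail (K n : nat) : C := K.+1%:R ^+ 2 * (if (n < K)%N then 0 else phi n).
pose trunc (K n : nat) : C := if (n < K)%N then phi n else 0.
have btail : schwartz_bounded tail.
  move=> M; have [A hA] := bphi M.+2; exists A => K n.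
  rewrite /tail; case: ltnP => [_|Kn].
    by rewrite mulr0 normr0 mulr0 (le_trans _ (hA tt 0%N))// mulr_ge0 ?exprn_ge0.
  rewrite (le_trans _ (hA tt n))// normrM mulrA ler_wpM2r//.
  rewrite -[M.+2]addn2 exprD ler_wpM2l ?exprn_ge0// ger0_norm ?exprn_ge0//.
  by rewrite lerXn2r ?nnegrE// ler_nat.
have [P hP] := bphi 2%N; have [Q hQ] := bphi 0%N.
have [S hS] := schwartz_bounded_fock u bphi 0%N.
have [T hT] := schwartz_bounded_fock u btail 0%N.
have phi_le n : `|phi n| <= Q by have := hQ tt n; rewrite mul1r.
have tail_le K n : `|fock u (tail K) n| <= T by have := hT K n; rewrite mul1r.
have ge0 (x : C) r : `|x| <= r -> 0 <= r by exact: le_trans.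
have Q0 := ge0 _ _ (phi_le 0%N); have T0 := ge0 _ _ (tail_le 0%N 0%N).
apply: (@series_ge0 _ (S * P) (T * Q)) => [n|K].
  rewrite normrM norm_conjC mulrCA ler_pM ?mulr_ge0 ?exprn_ge0//.
  - by have := hS tt n; rewrite mul1r.
  - exact: hP tt n.
have ftrunc : finsupp (trunc K) by exists K => n; rewrite /trunc ltnNge => ->.
exists (l2_inner (fock u (trunc K)) (trunc K)); first exact: upos.
rewrite (@l2_innerE K) => [|n Kn]; last by rewrite /trunc ltnNge Kn rmorph0 mulr0.
have splitphi : phi = (fun n => (K.+1%:R ^+ 2)^-1 * tail K n + trunc K n).
  apply/funext => n; rewrite mulKf ?expf_neq0 ?pnatr_eq0//.
  by rewrite /trunc; case: ifP; rewrite ?add0r ?addr0.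
rewrite /series /= big_mkord -sumrB.
have -> : \sum_(i < K) (fock u phi i * (phi i)^* -
      fock u (trunc K) i * (trunc K i)^*) =
    (K.+1%:R ^+ 2)^-1 * \sum_(i < K) fock u (tail K) i * (phi i)^*.
  rewrite mulr_sumr; apply: eq_bigr => i _.
  rewrite {2}/trunc ltn_ord -mulrBl mulrA; congr (_ * _).
  by rewrite {1}splitphi fock_linear addrK.
rewrite normrM normfV normrX normr_nat mulrA.
rewrite expr2 invfM mulrA mulfV ?pnatr_eq0// mul1r mulrC ler_pdivrMr//.
apply: le_trans (ler_norm_sum _ _ _) _.
apply: (@le_trans _ _ (\sum_(i < K) T * Q)).
  by apply: ler_sum => i _; rewrite normrM norm_conjC ler_pM.
rewrite sumr_const card_ord -[_ *+ K]mulr_natr ler_wpM2l ?mulr_ge0// ler_nat.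
exact: leqnSn.
Qed.

End FockPositivity.

Theorem proposition8p3 (R : realType) : weyl_pos R = Ind (Pos_nat R).
Proof.
apply/seteqP; split=> x.
  move=> [xx xpos]; apply/Ind_Pos_natP; split=> // phi fphi.
  by apply: xpos; exact: finsupp_fock_dom.
move=> /Ind_Pos_natP[xx xpos]; split=> // phi dphi; exact: fock_dom_ge0.
Qed.
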